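(* There exist exponentially many words over the ternary alphabet $\{0,1,2\}$ satisfying each of the following properties; that is, for each of (a), (b), (c) there is a real constant $c_0>1$ such that, for all sufficiently large $n$, at least $c_0^n$ ternary words of length $n$ have the property: (a) being $\tfrac{15}{8}^+$-free and avoiding the letter pattern $abaca$; (b) being $\tfrac{11}{6}^+$-free and avoiding the letter pattern $abcab$; (c) being $\tfrac{7}{4}^+$-free and avoiding the letter pattern $abacbc$.
   Context: For a nonempty finite word $u$ and a rational $r>1$, a word $v$ is an $r$-power (of $u$) if $v$ is a prefix of the infinite periodic word $uuu\cdots$ and $|v|/|u|=r$. A word is $\beta^+$-free if none of its factors is an $r$-power with $r>\beta$. A letter pattern is a finite word over variables $a,b,c,\dots$ in which each variable stands for one letter and different variables stand for different letters; a ternary word avoids a letter pattern if none of its factors is obtained from the pattern by substituting pairwise distinct letters of $\{0,1,2\}$ for the variables. For example, the occurrences of $abaca$ are $01020, 02010, 10121, 12101, 20212, 21202$. *)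

(* Defs.v *)
From HB Require Import structures.
From mathcomp Require Import all_boot all_order all_algebra.
From mathcomp Require Import boolp reals.

Set Implicit Arguments.
Unset Strict Implicit.
Unset Printing Implicit Defensive.

Import Order.TTheory GRing.Theory Num.Theory.
Local Open Scope ring_scope.

(* The ternary alphabet {0, 1, 2}. *)
Notation letter := 'I_3.

(* The infinite periodic word uuu..., meaningful for u nonempty. *)
Definition omega_word (u : seq letter) : nat -> letter :=
  fun i => nth ord0 u (i %% size u)%N.

Definition prefix_of_inf (v : seq letter) (x : nat -> letter) : Prop :=
  v = mkseq x (size v).

Definition is_power (r : rat) (v : seq letter) : Prop :=
  1 < r /\
  exists u : seq letter,
    [/\ u != [::], prefix_of_inf v (omega_word u)
      & (size v)%:R / (size u)%:R = r].

(* beta^+-freeness; a factor is a contiguous subword, i.e. an infix. *)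
Definition plus_free (beta : rat) (w : seq letter) : Prop :=
  forall (v : seq letter) (r : rat), infix v w -> beta < r -> ~ is_power r v.

(* A letter pattern is a word over the variables a = 0, b = 1, c = 2, ...
   Only the values of h on the variables occurring in p matter. *)
Definition pattern_occurrence (p : seq nat) (v : seq letter) : Prop :=
  exists2 h : nat -> letter, {in p &, injective h} & v = map h p.

Definition avoids_pattern (p : seq nat) (w : seq letter) : Prop :=
  forall v : seq letter, infix v w -> ~ pattern_occurrence p v.

Definition abaca : seq nat := [:: 0; 1; 0; 2; 0]%N.
Definition abcab : seq nat := [:: 0; 1; 2; 0; 1]%N.
Definition abacbc : seq nat := [:: 0; 1; 0; 2; 1; 2]%N.

Definition num_words (P : seq letter -> Prop) (n : nat) : nat :=
  #|[set w : n.-tuple letter | `[< P w >]]|.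

Definition exponentially_many (R : realType) (P : seq letter -> Prop) : Prop :=
  exists2 c0 : R, 1 < c0 &
    exists N : nat, forall n : nat, (N <= n)%N -> c0 ^+ n <= (num_words P n)%:R.

(* Main.v *)
(* Proof idea.  Over five letters, words all of whose repetitions have exponent
   at most 3/2 number at least 3^n in length n.  Indeed, if c_n counts them, a
   one-letter extension that fails starts with a repetition of some period p
   and excess p/2 + 1, and is recovered from p and its suffix of length
   n - p/2, so 5 c_n <= c_(n+1) + \sum_(p >= 1) c_(n - p/2); by induction the
   last sum is at most (1 + 2/3 + 2/9 + ...) c_n = 2 c_n.

   These words are mapped to ternary words by a q-uniform morphism h whose
   images all start with the same marker M, which occurs in h(a)M at no other
   place than its two ends.  A repetition in h(w) either lies in some
   h(a)h(b)M, which is a finite check, or contains a full copy of M in its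
   repeated part.  In the latter case its period is a multiple kq of q, and it
   comes from a repetition of period k in w, up to the common prefixes and
   suffixes of distinct images; these have total length at most q/2, which is
   too little to raise the exponent above 7/4.  Occurrences of the letter
   pattern are short, hence all covered by the finite check.  Each of the three
   parts has its own morphism. *)
Require Import Defs.
From HB Require Import structures.
From mathcomp Require Import all_boot all_order all_algebra.
From mathcomp Require Import boolp reals.
From mathcomp Require Import zify lra.

Set Implicit Arguments.
Unset Strict Implicit.
Unset Printing Implicit Defensive.

Import Order.TTheory GRing.Theory Num.Theory.

(* Every repetition of period p in x 0, ..., x (n - 1) has length at most
   (1 + num / den) * p: e is the excess of its length over p. *)
Definition rep_bounded (T : Type) (num den : nat) (x : nat -> T) (n : nat) :=
  forall i p e, 0 < p -> i + p + e <= n ->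
    (forall j, j < e -> x (i + j) = x (i + p + j)) -> den * e <= num * p.

(** * Uniform morphisms with a marker *)

Section Morphism.

Variables (h : nat -> seq nat) (K q m : nat) (M : seq nat) (W : nat -> nat).

Hypothesis m_gt0 : 0 < m.
Hypothesis m_small : 2 * m <= q.
Hypothesis size_M : size M = m.
Hypothesis size_h : forall a, a < K -> size (h a) = q.
Hypothesis h_M : forall a, a < K -> take m (h a) = M.
Hypothesis W_K : forall t, W t < K.

(* The image of the infinite word W; only its first n letters are constrained
   below, so that M also follows the image of the last letter of a finite word. *)
Let H x := nth 0 (h (W (x %/ q))) (x %% q).

Let q0 : 0 < q.
Proof. lia. Qed.

Lemma H_block t r : r < q -> H (t * q + r) = nth 0 (h (W t)) r.
Proof. by move=> rq; rewrite /H divnMDl // modnMDl divn_small // modn_small // addn0. Qed.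

Lemma H_marker t r : r < m -> H (t * q + r) = nth 0 M r.
Proof.
move=> rm; rewrite H_block; last by lia.
by rewrite -(h_M (W_K t)) nth_take.
Qed.

Lemma H_window t i : i < 2 * q + m.-1 ->
  H (t * q + i) = nth 0 (h (W t) ++ h (W t.+1) ++ take m.-1 M) i.
Proof.
move=> lti; rewrite !nth_cat !size_h //.
case: ltnP => [iq|qi]; first exact: H_block.
case: ltnP => [iq|q2i].
  by rewrite -(H_block t.+1) //; congr (H _); lia.
rewrite nth_take; last by lia.
by rewrite -(H_marker t.+2); [congr (H _)|]; lia.
Qed.

Variables num den cp cs n : nat.
Hypothesis h_sync : forall a i, a < K -> 0 < i < q ->
  take m (drop i (h a ++ M)) != M.
Hypothesis h_pairs : forall a b, a < K -> b < K -> a <> b ->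
  rep_bounded num den (nth 0 (h a ++ h b ++ take m.-1 M)) (2 * q + m.-1).
(* Distinct images have at most cp letters of common prefix, cs of common suffix. *)
Hypothesis h_pref : forall a b, a < K -> b < K -> a <> b ->
  take cp.+1 (h a) <> take cp.+1 (h b).
Hypothesis h_suff : forall a b, a < K -> b < K -> a <> b ->
  drop (q - cs.+1) (h a) <> drop (q - cs.+1) (h b).
Hypothesis common_small : 2 * (cp + cs) <= q.
Hypothesis ratio : 3 * den <= 4 * num.
Hypothesis den_gt0 : 0 < den.
Hypothesis W_adj : forall t, t < n -> W t <> W t.+1.
Hypothesis W_rep : rep_bounded 1 2 W n.

(** A copy of [M] that starts inside a block ends no later than the next marker, so it lies in some
    [h a ++ M], where [h_sync] leaves only offset 0. *)
Lemma marker_at x : (forall j, j < m -> H (x + j) = nth 0 M j) -> q %| x.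
Proof.
move=> HM; rewrite /dvdn; apply/negPn/negP => nz.
have rq : x %% q < q by rewrite ltn_pmod.
have rI : 0 < x %% q < q by rewrite lt0n nz.
have := h_sync (W_K (x %/ q)) rI; case/negP; apply/eqP.
have szd : size (drop (x %% q) (h (W (x %/ q)) ++ M)) = q + m - x %% q.
  by rewrite size_drop size_cat size_h // size_M.
have szt : size (take m (drop (x %% q) (h (W (x %/ q)) ++ M))) = m.
  by rewrite size_takel // szd; lia.
apply: (@eq_from_nth _ 0) => [|j]; rewrite szt ?size_M // => jm.
rewrite nth_take // nth_drop nth_cat size_h // -(HM j) //.
have -> : x + j = x %/ q * q + (x %% q + j) by rewrite addnA -divn_eq.
case: ltnP => jq; first by rewrite H_block.
rewrite -(H_marker (x %/ q).+1); last by lia.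
congr (H _); lia.
Qed.

Lemma block_inj a b : a < K -> b < K ->
  (forall r, r <= cp -> nth 0 (h a) r = nth 0 (h b) r) -> a = b.
Proof.
move=> aK bK E; case: (eqVneq a b) => // /eqP ne; case: (h_pref aK bK ne).
have sz c : c < K -> size (take cp.+1 (h c)) = minn cp.+1 q.
  by move=> cK; rewrite size_take_min size_h.
apply: (@eq_from_nth _ 0) => [|j]; rewrite !sz // => jm.
rewrite !nth_take ?E //; lia.
Qed.

Lemma block_inj_suff a b : a < K -> b < K ->
  (forall r, q - cs.+1 <= r < q -> nth 0 (h a) r = nth 0 (h b) r) -> a = b.
Proof.
move=> aK bK E; case: (eqVneq a b) => // /eqP ne; case: (h_suff aK bK ne).
have sz c : c < K -> size (drop (q - cs.+1) (h c)) = q - (q - cs.+1).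
  by move=> cK; rewrite size_drop size_h.
apply: (@eq_from_nth _ 0) => [|j]; rewrite !sz // => jm.
by rewrite !nth_drop E //; lia.
Qed.

Lemma morphism_rep_bounded : rep_bounded num den H (n * q).
Proof.
move=> s p e p0 le_n per; rewrite leqNgt; apply/negP => big.
have e34 : 3 * p < 4 * e by nia.
pose t := s %/ q; pose r := s %% q.
have Es : s = t * q + r by apply: divn_eq.
have rq : r < q by rewrite ltn_pmod.
have tn : t < n.
  by rewrite /t ltn_divLR //; lia.
have [short|long] := leqP (r + p + e) (2 * q + m.-1).
  suff : den * e <= num * p by lia.
  apply: (h_pairs (W_K t) (W_K t.+1) (W_adj tn) p0 short) => j je.
  rewrite -!H_window; try lia.
  have := per j je; rewrite Es; congr (H _ = H _); lia.
(* A marker inside either copy of the repeated part recurs at distance [p], so [marker_at] applies.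
   If the first copy misses the marker at [t.+1 * q] and the second the one at [t.+2 * q], then
   [e < q + m - r] and [p > 2 * q - r], so [3 * p < 4 * e] gives [2 * q < 4 * m]. *)
have /dvdnP[k Ek] : q %| p.
  have sync t' : s <= t' * q -> t' * q + m <= s + e -> q %| p.
    move=> lo hi; suff : q %| t' * q + p by rewrite dvdn_addr // dvdn_mull.
    apply: marker_at => j jm; rewrite -(H_marker t' jm).
    have -> : t' * q + p + j = s + p + (t' * q - s + j) by lia.
    by rewrite -per; [congr (H _)|]; lia.
  have sync' t' : s + p <= t' * q -> t' * q + m <= s + p + e -> q %| p.
    move=> lo hi; suff : q %| t' * q - p.
      move=> d; have := dvdn_sub (dvdn_mull t' (dvdnn q)) d.
      by have -> : t' * q - (t' * q - p) = p by lia.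
    apply: marker_at => j jm; rewrite -(H_marker t' jm).
    have -> : t' * q - p + j = s + (t' * q - p - s + j) by lia.
    by rewrite per; [congr (H _)|]; lia.
  have [x1|x1] := leqP (t.+1 * q + m) (s + e); first by apply: sync x1; lia.
  have [x2|x2] := leqP (s + p) (t.+2 * q); first by apply: (sync' t.+2); lia.
  nia.
have k0 : 0 < k by move: p0; rewrite Ek; case: (k).
pose T := (s + e) %/ q; pose r' := (s + e) %% q.
have ET : s + e = T * q + r' by apply: divn_eq.
have rq' : r' < q by rewrite ltn_pmod.
have shift u v : v < q -> s <= u * q + v < s + e ->
    nth 0 (h (W u)) v = nth 0 (h (W (u + k))) v.
  move=> vq uv; rewrite -!H_block //.
  have := per (u * q + v - s); rewrite Ek.
  have -> : s + (u * q + v - s) = u * q + v by lia.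
  have -> : s + k * q + (u * q + v - s) = (u + k) * q + v by lia.
  by apply; lia.
(* The repeated part reaches the end of block [t]: by [long] if [k = 1], and otherwise because [e]
   exceeds 3/4 of [2 * q]. *)
have tT : t < T.
  suff : t.+1 * q < T.+1 * q by rewrite ltn_pmul2r.
  have [k1|k1] : k = 1 \/ 2 <= k by lia.
    by rewrite Ek k1 in long; lia.
  have : 2 * q <= p by rewrite Ek leq_pmul2r.
  lia.
have eqW u : t < u < T -> W u = W (u + k).
  move=> uT; apply: block_inj => // v vcp; apply: shift; first by lia.
  have : t.+1 * q <= u * q by rewrite leq_pmul2r //; case/andP: uT.
  have : u.+1 * q <= T * q by rewrite leq_pmul2r //; case/andP: uT.
  lia.
(* The end blocks, possibly covered only in part, are included when their letters agree too. The
   test [0 < r'] ensures that the repetition meets block [T + k], whence [T + k < n]. *)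
pose A := if W t == W (t + k) then t else t.+1.
pose B := if (0 < r') && (W T == W (T + k)) then T.+1 else T.
have AB : A <= B by rewrite /A /B; case: ifP; case: ifP; lia.
have eqAB u : A <= u < B -> W u = W (u + k).
  rewrite /A /B; case: eqP => EA; case: ifP => [/andP[_ /eqP EB]|_] uAB.
  - by have [-> //|[-> //|/eqW]] : u = t \/ u = T \/ t < u < T by lia.
  - by have [-> //|/eqW] : u = t \/ t < u < T by lia.
  - by have [-> //|/eqW] : u = T \/ t < u < T by lia.
  - by apply: eqW; lia.
have Bn : B + k <= n.
  rewrite -(leq_pmul2r q0) mulnDl -Ek.
  rewrite /B; case: ifP => [/andP[r0 _]|_]; last by lia.
  have : (T + k) * q < n * q by lia.
  by rewrite ltn_pmul2r // => /(leq_mul (leqnn q)); lia.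
(* The letters of index in [A, B) and their translates by k agree, while s and
   s + e overshoot A * q and B * q by at most cs and cp letters. *)
have F2 : 2 * (B - A) <= k.
  rewrite -[k in _ <= k]mul1n; apply: (W_rep (i := A)) => //; first by lia.
  by move=> j jB; rewrite eqAB; [congr (W _)|]; lia.
have tTq : t.+1 * q <= T * q by rewrite leq_pmul2r.
have EA : A * q <= s + cs.
  rewrite /A; case: eqP => [_|NE]; first by lia.
  rewrite leqNgt; apply/negP => lt; apply: NE.
  by apply: block_inj_suff => // v vq; apply: shift; lia.
have EB : s + e <= B * q + cp.
  rewrite /B; case: ifP => [_|NE]; first by lia.
  rewrite leqNgt; apply/negP => lt.
  have r0 : 0 < r' by lia.
  move: NE; rewrite r0 /=; case/eqP.
  by apply: block_inj => // v vq; apply: shift; lia.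
have : e <= (B - A) * q + (cp + cs) by rewrite mulnBl; lia.
have F2q : 2 * ((B - A) * q) <= k * q by rewrite mulnA leq_pmul2r.
rewrite Ek in e34 => eF.
(* Now [3 * k * q < 4 * e <= 2 * k * q + 2 * q] forces [k = 1] and [B - A = 0]; then [2 * e <= q],
   against [3 * q < 4 * e]. *)
have k1 : k * q < 2 * q by lia.
rewrite ltn_pmul2r // in k1.
have k1' : k = 1 by lia.
have F0 : B - A = 0 by lia.
by move: e34 eF; rewrite F0 k1'; lia.
Qed.

End Morphism.

(** * Five-letter words with repetitions of exponent at most 3/2 *)

(* Words grow to the left, so that a new repetition is a prefix; p./2.+1 is
   the least excess that violates the bound for period p. *)
Definition starts_with_rep (w : seq nat) (p : nat) :=
  (p + p./2.+1 <= size w) && (take p./2.+1 w == take p./2.+1 (drop p w)).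

Definition good_head (w : seq nat) := ~~ has (starts_with_rep w) (iota 1 (size w)).

Fixpoint low_exp_words (n : nat) : seq (seq nat) :=
  if n is n'.+1 then [seq w <- [seq a :: w | a <- iota 0 5, w <- low_exp_words n'] | good_head w]
  else [:: [::]].

Lemma low_exp_wordsS n :
  low_exp_words n.+1 = [seq w <- [seq a :: w | a <- iota 0 5, w <- low_exp_words n] | good_head w].
Proof. by []. Qed.

Lemma low_exp_words_cons n a w :
  (a :: w \in low_exp_words n.+1) = [&& a < 5, w \in low_exp_words n & good_head (a :: w)].
Proof.
rewrite low_exp_wordsS mem_filter andbC andbA; congr andb.
apply/allpairsP/andP => [[[b v] [/= b5 vw [-> ->]]]|[a5 ww]].
  by rewrite vw; move: b5; rewrite (mem_iota 0 5).
by exists (a, w); rewrite (mem_iota 0 5).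
Qed.

Lemma low_exp_words_size n w : w \in low_exp_words n -> size w = n.
Proof.
elim: n w => [|n IH] [|a w] //.
  by rewrite low_exp_wordsS mem_filter andbC; case/andP => /allpairsP[[? ?]] [].
by rewrite low_exp_words_cons => /and3P[_ /IH /= -> _].
Qed.

Lemma low_exp_words_letter n w : w \in low_exp_words n -> all (gtn 5) w.
Proof.
elim: n w => [|n IH] [|a w] //.
by rewrite low_exp_words_cons /= => /and3P[-> /IH ->].
Qed.

Lemma low_exp_words_uniq n : uniq (low_exp_words n).
Proof.
elim: n => // n IH; rewrite low_exp_wordsS filter_uniq // allpairs_uniq ?iota_uniq //.
by move=> [a w] [b v] _ _ /= [-> ->].
Qed.

Lemma low_exp_words_drop n k w : w \in low_exp_words n -> drop k w \in low_exp_words (n - k).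
Proof.
elim: k n w => [|k IH] [|n] [|a w]; rewrite ?drop0 ?subn0 //; first by move/low_exp_words_size.
by rewrite low_exp_words_cons => /and3P[_ /IH].
Qed.

Lemma low_exp_words_rep n w : w \in low_exp_words n -> rep_bounded 1 2 (nth 0 w) n.
Proof.
elim: n w => [|n IH] [|a w].
- by move=> _ i p e; lia.
- by [].
- by move/low_exp_words_size.
move=> aw; have sz := low_exp_words_size aw; move: aw.
rewrite low_exp_words_cons => /and3P[_ /IH repw /hasPn good] [|i] p e p0 le per; last first.
  by by apply: (repw i p e p0) => [|j /per]; first by lia.
rewrite leqNgt; apply/negP => big.
have : p \in iota 1 (size (a :: w)) by rewrite mem_iota sz; lia.
move/good; case/negP; rewrite /starts_with_rep sz; apply/andP; split; first by lia.
apply/eqP/(@eq_from_nth _ 0) => [|j]; rewrite !size_take_min ?size_drop sz; first by lia.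
by move=> je; rewrite !nth_take ?nth_drop; try lia; apply: (per j); lia.
Qed.

Definition num_low_exp n := size (low_exp_words n).

(* A bad extension starting with a repetition of period p is recovered from its
   suffix without the first p./2.+1 letters, which are copied p places later. *)
Lemma bad_extensions n :
  5 * num_low_exp n <= num_low_exp n.+1 + \sum_(1 <= p < n.+2) num_low_exp (n - p./2).
Proof.
pose ext := [seq a :: w | a <- iota 0 5, w <- low_exp_words n].
have -> : 5 * num_low_exp n = size ext by rewrite size_allpairs size_iota.
rewrite -(count_predC good_head) -size_filter leq_add2l -size_filter.
(* As [u] lacks the first [p./2.+1] letters of [w], position [p] of [w] is position [p - p./2.+1] of
   [u]. *)
pose back p := [seq take p./2.+1 (drop (p - p./2.+1) u) ++ u | u <- low_exp_words (n - p./2)].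
suff sub : {subset [seq w <- ext | predC good_head w] <= flatten [seq back p | p <- iota 1 n.+1]}.
  apply: leq_trans (uniq_leq_size _ sub) _.
    rewrite filter_uniq // allpairs_uniq ?iota_uniq ?low_exp_words_uniq //.
    by move=> [a w] [b v] _ _ /= [-> ->].
  rewrite size_flatten /shape -map_comp sumnE big_map /index_iota subSS subn0.
  by under eq_bigr => p _ do rewrite /= size_map.
move=> w; rewrite mem_filter [predC _ _]negbK => /andP[/hasP[p]].
rewrite mem_iota => pI /andP[le /eqP rep] /allpairsP[[a v] /= [_ vw Ew]].
have szv := low_exp_words_size vw.
have szw : size w = n.+1 by rewrite Ew /= szv.
apply/(@flatten_mapP _ _ back (iota 1 n.+1)); exists p.
  by rewrite mem_iota -szw.
apply/mapP; exists (drop p./2.+1 w).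
  by rewrite Ew /=; apply: low_exp_words_drop.
rewrite drop_drop -[LHS](cat_take_drop p./2.+1); congr (_ ++ _).
by rewrite rep; congr (take _ (drop _ _)); lia.
Qed.

Lemma num_low_exp_grow n : 3 * num_low_exp n <= num_low_exp n.+1.
Proof.
elim/ltn_ind: n => n IH.
(* The extra last term carries the geometric series: step [k.+1] adds two copies of
   [num_low_exp (n - k.+1)], and with the new last term these three are at most the old last
   term. *)
have sum k : k <= n ->
    \sum_(1 <= p < (2 * k).+2) num_low_exp (n - p./2) + num_low_exp (n - k) <= 2 * num_low_exp n.
  elim: k => [_|k IHk kn].
    by rewrite muln0 big_nat1 subn0; lia.
  have -> : (2 * k.+1).+2 = (2 * k).+4 by lia.
  have -> F : \sum_(1 <= p < (2 * k).+4) F p =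
      \sum_(1 <= p < (2 * k).+2) F p + F (2 * k).+2 + F (2 * k).+3.
    by rewrite 2?big_nat_recr.
  have -> : (2 * k).+2./2 = k.+1 by lia.
  have -> : (2 * k).+3./2 = k.+1 by lia.
  have := IHk (ltnW kn); have := IH (n - k.+1).
  have -> : (n - k.+1).+1 = n - k by lia.
  lia.
have := sum n (leqnn n); have := bad_extensions n.
have : \sum_(1 <= p < n.+2) num_low_exp (n - p./2)
    <= \sum_(1 <= p < (2 * n).+2) num_low_exp (n - p./2).
  by rewrite [leqRHS](@big_cat_nat _ _ _ n.+2) /= ?leq_addr //; lia.
lia.
Qed.

Lemma num_low_exp_exp n : 3 ^ n <= num_low_exp n.
Proof.
elim: n => // n IH; rewrite expnS; apply: leq_trans (num_low_exp_grow n).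
by rewrite leq_mul2l.
Qed.

(** * Verification of a morphism *)

(** An injective substitution exists exactly when equal letters sit at the same pairs of positions;
    this form can be tested without naming it. *)
Definition pattern_at (T : eqType) (p : seq nat) (x : nat -> T) (s : nat) :=
  forall i j, i < size p -> j < size p ->
    (x (s + i) == x (s + j)) = (nth 0 p i == nth 0 p j).

Definition pattern_free (T : eqType) (p : seq nat) (x : nat -> T) (n : nat) :=
  forall s, s + size p <= n -> ~ pattern_at p x s.

(* Every run of agreeing positions of s and t has length at most lim, and an
   initial one at most c. *)
Fixpoint runs_bounded (lim c : nat) (s t : seq nat) : bool :=
  match s, t with
  | x :: s', y :: t' =>
      if eqn x y then (if c is c'.+1 then runs_bounded lim c' s' t' else false)
      else runs_bounded lim lim s' t'
  | _, _ => true
  end.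

Lemma runs_boundedP lim c s t i e : c <= lim -> runs_bounded lim c s t ->
  i + e <= size s -> i + e <= size t ->
  (forall j, j < e -> nth 0 s (i + j) = nth 0 t (i + j)) ->
  e <= if i is 0 then c else lim.
Proof.
elim: s t c i e => [|x s IH] [|y t] c i e //= cl; try by case: i => [|i]; lia.
case: eqnP => [Exy|nxy].
  case: c cl => // c cl ok; case: i => [|i] les le_t run.
    case: e les le_t run => // e les le_t run.
    by apply: (IH _ _ 0 e (ltnW cl) ok) => // j je; apply: (run j.+1).
  have := IH _ _ i e (ltnW cl) ok les le_t (fun j je => run j je).
  by case: (i) => // ?; lia.
move=> ok; case: i => [|i] les le_t run.
  by case: e les le_t run => // e _ _ /(_ 0 (ltn0Sn _)).
have := IH _ _ i e (leqnn _) ok les le_t (fun j je => run j je).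
by case: (i).
Qed.

Definition limits num den n := [seq (p, num * p %/ den) | p <- iota 1 n].

(** A repetition of period [p] is a run of positions where [w] agrees with [drop p w], so each
    period takes one linear pass. *)
Definition check_rep (lims : seq (nat * nat)) (w : seq nat) :=
  all (fun pl => runs_bounded pl.2 pl.2 (drop pl.1 w) w) lims.

Lemma check_repP num den n w : 0 < den -> size w = n ->
  check_rep (limits num den n) w -> rep_bounded num den (nth 0 w) n.
Proof.
move=> den0 szw /allP ok i p e p0 le run.
rewrite mulnC -leq_divRL //.
have {}ok : runs_bounded (num * p %/ den) (num * p %/ den) (drop p w) w.
  by apply: (ok (p, num * p %/ den)); apply: map_f; rewrite mem_iota; lia.
have := @runs_boundedP _ _ _ _ i e (leqnn _) ok.
rewrite size_drop szw; case: (i) run le => [|k] run le.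
all: apply; try lia; move=> j je; rewrite nth_drop run //; congr nth; lia.
Qed.

Definition matches (p v : seq nat) :=
  let I := iota 0 (size p) in
  (size v == size p) &&
  all (fun i => all (fun j => eqn (nth 0 v i) (nth 0 v j) == eqn (nth 0 p i) (nth 0 p j)) I) I.

Fixpoint check_pattern (p w : seq nat) :=
  if w is _ :: w' then ~~ matches p (take (size p) w) && check_pattern p w' else true.

Lemma check_patternP p w n : 0 < size p -> size w = n ->
  check_pattern p w -> pattern_free p (nth 0 w) n.
Proof.
move=> p0; elim: w n => [|x w IH] n /= <-; first by move=> _ s; lia.
move=> /andP[nm ok] [|s] le occ; last by apply: (IH _ erefl ok s) => // i j; apply: occ.
case/negP: nm; apply/andP; split; first by apply/eqP; rewrite size_takel.
apply/allP => i; rewrite mem_iota => iI; apply/allP => j; rewrite mem_iota => jI.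
by rewrite !nth_take //; apply/eqP; exact: (occ i j iI jI).
Qed.

(** Each hypothesis on the images becomes a finite test. The bound [size p <= q] keeps a pattern
    occurrence within two adjacent blocks. *)
Definition check_images num den (p : seq nat) m cp cs (imgs : seq (seq nat)) :=
  let q := size (head [::] imgs) in
  let M := take m (head [::] imgs) in
  let lims := limits num den (2 * q + m.-1) in
  let tl := take m.-1 M in
  [&& size imgs == 5, 0 < m, 2 * m <= q, 2 * (cp + cs) <= q, 3 * den <= 4 * num, 0 < den,
      0 < size p <= q,
      all (fun u => [&& size u == q, take m u == M, all (gtn 3) u
             & all (fun i => take m (drop i (u ++ M)) != M) (iota 1 q.-1)]) imgs
    & all (fun a => all (fun b => let u := nth [::] imgs a in let v := nth [::] imgs b in
         (a == b) || [&& take cp.+1 u != take cp.+1 v,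
           drop (q - cs.+1) u != drop (q - cs.+1) v,
           check_rep lims (u ++ v ++ tl) & check_pattern p (u ++ v ++ tl)])
       (iota 0 5)) (iota 0 5)].

Section Images.

Variables (num den : nat) (p : seq nat) (m cp cs : nat) (imgs : seq (seq nat)).
Hypothesis ok : check_images num den p m cp cs imgs.

Let h := nth [::] imgs.
Let q := size (head [::] imgs).

Definition image (w : seq nat) := flatten [seq nth [::] imgs a | a <- w].

Lemma imgs_q_gt0 : 0 < q.
Proof. by case/and5P: ok => *; lia. Qed.

Lemma size_img a : a < 5 -> size (h a) = q.
Proof.
case/and5P: ok => /eqP sz _ _ _ /and5P[_ _ _ /allP H _] a5.
by have /H/and4P[/eqP] : h a \in imgs by rewrite mem_nth ?sz.
Qed.

Lemma img_letter a : a < 5 -> all (gtn 3) (h a).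
Proof.
case/and5P: ok => /eqP sz _ _ _ /and5P[_ _ _ /allP H _] a5.
by have /H/and4P[] : h a \in imgs by rewrite mem_nth ?sz.
Qed.

Lemma size_image w : all (gtn 5) w -> size (image w) = size w * q.
Proof. by elim: w => //= a w IH /andP[a5 w5]; rewrite size_cat size_img // IH. Qed.

Lemma image_letter w : all (gtn 5) w -> all (gtn 3) (image w).
Proof. by elim: w => //= a w IH /andP[a5 w5]; rewrite all_cat img_letter // IH. Qed.

Lemma nth_image d w x : all (gtn 5) w -> x < size w * q ->
  nth 0 (image w) x = nth 0 (h (nth d w (x %/ q))) (x %% q).
Proof.
have q0 := imgs_q_gt0.
elim: w x => //= a w IH x /andP[a5 w5] lt.
rewrite nth_cat size_img //; case: ltnP => xq.
  by rewrite divn_small // modn_small.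
rewrite IH //; last by lia.
by rewrite -{3 4}(subnKC xq) divnDl // divnn q0 modnDl.
Qed.

Lemma h_inj a b : a < 5 -> b < 5 -> h a = h b -> a = b.
Proof.
case/and5P: ok => _ _ _ _ /and5P[_ _ _ _ /allP H] a5 b5 E.
have /H/allP : a \in iota 0 5 by rewrite mem_iota.
have bI : b \in iota 0 5 by rewrite mem_iota.
by move/(_ b bI) => /orP[/eqP //|/and4P[]]; rewrite -/(h a) E eqxx.
Qed.

Lemma image_inj v w : all (gtn 5) v -> all (gtn 5) w -> size v = size w ->
  image v = image w -> v = w.
Proof.
elim: v w => [|a v IH] [|b w] //= /andP[a5 v5] /andP[b5 w5] [sz] /eqP.
rewrite eqseq_cat ?size_img // => /andP[/eqP/h_inj -> // /eqP].
by move/IH => ->.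
Qed.

Lemma image_good n w : w \in low_exp_words n ->
  rep_bounded num den (nth 0 (image w)) (n * q) /\ pattern_free p (nth 0 (image w)) (n * q).
Proof.
move=> wn; have w5 := low_exp_words_letter wn; have sz := low_exp_words_size wn.
(* Any letter other than the last one of w may continue it. *)
pose d : nat := last 0 w == 0; pose W := nth d w.
have d5 : d < 5 by rewrite /d; case: eqP.
have W5 t : W t < 5.
  rewrite /W; have [tn|tn] := ltnP t (size w); last by rewrite nth_default.
  exact: (all_nthP d w5).
have Wrep : rep_bounded 1 2 W n.
  move=> i r e r0 le run; apply: (low_exp_words_rep wn r0 le) => j je.
  by have := run j je; rewrite /W !(set_nth_default 0 d) ?sz //; lia.
(* Equal neighbours would be a repetition of period 1 and excess 1; past the end, [d] differs from
   the last letter by choice. *)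
have Wadj t : t < n -> W t <> W t.+1.
  move=> tn E; have [t1|t1] := ltnP t.+1 n.
    suff : 2 * 1 <= 1 * 1 by [].
    apply: (Wrep t 1 1) => // [|j]; rewrite !addn1 //.
    by rewrite ltnS leqn0 => /eqP ->; rewrite !addn0.
  have {}t1 : n = t.+1 by lia.
  have : W t = last 0 w.
    by rewrite /W (set_nth_default 0 d) ?sz // -nth_last sz t1.
  by rewrite E /W nth_default ?sz ?t1 // /d; case: eqP => [->|ne /esym].
have EH x : x < n * q -> nth 0 (image w) x = nth 0 (h (W (x %/ q))) (x %% q).
  by move=> xn; apply: nth_image; rewrite ?sz.
case/and5P: ok => /eqP szi m0 mq cq /and5P[ratio den0 /andP[p0 pq] /allP Hu /allP Hp].
pose M := take m (head [::] imgs).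
have szM : size M = m by rewrite size_takel //; lia.
have pairs a b : a < 5 -> b < 5 -> a <> b ->
    [&& take cp.+1 (h a) != take cp.+1 (h b),
        drop (q - cs.+1) (h a) != drop (q - cs.+1) (h b),
        check_rep (limits num den (2 * q + m.-1)) (h a ++ h b ++ take m.-1 M)
      & check_pattern p (h a ++ h b ++ take m.-1 M)].
  move=> a5 b5 /eqP/negPf ab.
  have /Hp/allP : a \in iota 0 5 by rewrite mem_iota.
  have bI : b \in iota 0 5 by rewrite mem_iota.
  by move/(_ b bI); rewrite ab.
have szp a b : a < 5 -> b < 5 -> size (h a ++ h b ++ take m.-1 M) = 2 * q + m.-1.
  by move=> a5 b5; rewrite !size_cat !size_img // size_takel ?szM; lia.
have imgM a : a < 5 -> take m (h a) = M.
  by move=> a5; have /Hu/and4P[_ /eqP] : h a \in imgs by rewrite mem_nth ?szi.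
split.
  have good : rep_bounded num den (fun x => nth 0 (h (W (x %/ q))) (x %% q)) (n * q).
    apply: (@morphism_rep_bounded h 5 q m M W m0 mq szM size_img imgM W5 num den cp cs) => //.
    - move=> a i a5 iq; have : h a \in imgs by rewrite mem_nth ?szi.
      by case/Hu/and4P => _ _ _ /allP; apply; rewrite mem_iota; lia.
    - move=> a b a5 b5 ab; case/and4P: (pairs a b a5 b5 ab) => _ _ + _.
      by apply: check_repP => //; apply: szp.
    - by move=> a b a5 b5 ab; case/and4P: (pairs a b a5 b5 ab) => /eqP.
    - by move=> a b a5 b5 ab; case/and4P: (pairs a b a5 b5 ab) => _ /eqP.
  move=> i r e r0 le run; apply: (good i r e r0 le) => j je.
  by rewrite -!EH; [exact: run | lia | lia].
move=> s le occ; have q0 := imgs_q_gt0.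
have Es := divn_eq s q; set t := s %/ q in Es; set r := s %% q in Es.
have rq : r < q by rewrite ltn_pmod.
have tn : t < n by rewrite /t ltn_divLR //; lia.
have := pairs _ _ (W5 t) (W5 t.+1) (Wadj t tn); case/and4P => _ _ _.
move/(check_patternP p0 (szp _ _ (W5 t) (W5 t.+1)))/(_ r); apply; first by lia.
have win i : i < size p ->
    nth 0 (h (W t) ++ h (W t.+1) ++ take m.-1 M) (r + i) = nth 0 (image w) (s + i).
  move=> ip; rewrite -(@H_window h 5 q m M W m0 mq szM size_img imgM W5); last by lia.
  by rewrite -EH; [congr nth|]; lia.
by move=> i j ip jp; rewrite !win // occ.
Qed.

End Images.

(** * The three morphisms *)

Fixpoint digit_seq (u : Decimal.uint) : seq nat :=
  match u with
  | Decimal.Nil => [::]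
  | Decimal.D0 u => 0 :: digit_seq u
  | Decimal.D1 u => 1 :: digit_seq u
  | Decimal.D2 u => 2 :: digit_seq u
  | Decimal.D3 u | Decimal.D4 u | Decimal.D5 u | Decimal.D6 u
  | Decimal.D7 u | Decimal.D8 u | Decimal.D9 u => digit_seq u
  end.

Definition digits (u : Number.uint) := if u is Number.UIntDecimal u then digit_seq u else [::].
Arguments digits u%_dec_uint_scope.

(* The images were found by a randomized backtracking search among the words
   that lead from one occurrence of a marker to the next one. *)
Definition images_a := [::
  digits 0210120102120121020120210120102101202102012102120102101202102012021012010210120210201210212012102012021020121021201021012010212012102120102101202102012;
  digits 0210120102120121020120210120102101202102012102120121020120210201210212010210120102120121021201021012021020121021201210201202102012102120102101202102012;
  digits 0210120102120121020120210120102101202102012021012010212012102120102101202102012102120121020120210201210212010210120102120121021201021012021020121021201;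
  digits 0210120102120121020120210201210212010210120210201210212012102012021020121021201021012010212012102120102101202102012102120121020120210120102120121021201;
  digits 0210120102120121020120210201210212012102012021012010212012102120102101202102012102120121020120210201210212010210120210201202101201021012021020121021201].

(** Here 15/8 = 1 + 7/8, the marker has 25 letters, and distinct images share at most 50 letters of
    prefix and 25 of suffix. The other two checks read likewise. *)
Lemma check_a : check_images 7 8 abaca 25 50 25 images_a.
Proof. by vm_compute. Qed.

Definition images_b := [::
  digits 0210121020102120102012102010212021012021201020121020102120102012101202120102120210120212010201210120210121020102120210120212010212;
  digits 0210121020102120102012102010212021012021201020121012021012102012101202120102120210121020121012021012102010212021012021201020121012;
  digits 0210121020102120102012102010212021012021201021202101210201210120212010212021012021201020121012021012102010212010201210120212010212;
  digits 0210121020102120102012102010212021012102012101202101210201021202101202120102120210121020121012021201020121020102120210121020121012;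
  digits 0210121020102120102012102010212021012102012101202120102120210121020102120102012101202101210201210120212010201210201021201020121012].

Lemma check_b : check_images 5 6 abcab 27 50 15 images_b.
Proof. by vm_compute. Qed.

Definition images_c := [::
  digits 101201021012102120210201021012010201202120121021202102010210121021201210120102012021201210212021020120212012101201021012102120121012010201202102010210120102012021201210212021020102101210212012;
  digits 101201021012102120210201021012010201202120121021202102012021201210120102012021020102101210212021020120212012102120210201021012102120121012010201202102010210120102012021201210212021020120212012;
  digits 101201021012102120210201021012010201202102010210121021202102012021201210212021020102101201020120212012101201021012102120121012010201202120121021202102012021201210120102012021020102101210212012;
  digits 101201021012102120210201021012010201202102010210121021202102012021201210120102012021020102101201020120212012102120210201202120121012010210121021201210120102012021020102101210212021020120212012;
  digits 101201021012102120210201021012010201202102010210121021201210120102012021201210212021020102101201020120210201021012102120210201202120121012010210121021201210120102012021020102101201020120212012].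

Lemma check_c : check_images 3 4 abacbc 30 72 23 images_c.
Proof. by vm_compute. Qed.

(** * Transfer to words over [letter], and their number *)

Definition to_letter (d : nat) : letter := inord d.

Lemma val_to_letter d : d < 3 -> to_letter d = d :> nat.
Proof. by move=> d3; rewrite inordK. Qed.

Lemma to_letter_inj u v : all (gtn 3) u -> all (gtn 3) v ->
  map to_letter u = map to_letter v -> u = v.
Proof.
move=> u3 v3 /(congr1 (map val)); rewrite -!map_comp.
have E w : all (gtn 3) w -> map (val \o to_letter) w = w.
  by move/allP => w3; apply: map_id_in => d /w3; apply: val_to_letter.
by rewrite !E.
Qed.

Lemma letter_eq u i j : all (gtn 3) u -> i < size u -> j < size u ->
  (nth ord0 (map to_letter u) i == nth ord0 (map to_letter u) j) = (nth 0 u i == nth 0 u j).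
Proof.
move=> u3 iu ju; rewrite !(nth_map 0) // -val_eqE /= !val_to_letter //.
all: exact: (all_nthP 0 u3).
Qed.

(** A power of [v0] has period [size v0] and excess [size v - size v0]; as [beta] is
    [1 + num / den], bounding excesses bounds exponents. *)
Lemma rep_bounded_plus_free num den (beta : rat) u : 0 < den ->
  (den%:R * beta = (num + den)%:R)%R -> all (gtn 3) u ->
  rep_bounded num den (nth 0 u) (size u) -> plus_free beta (map to_letter u).
Proof.
move=> den0 Ebeta u3 rep v r /infixP[s1 [s2 Eu]] lt [_ [v0 [v0n Ev Er]]].
have p0 : 0 < size v0 by rewrite lt0n size_eq0.
have szu : size u = size s1 + (size v + size s2) by rewrite -(size_map to_letter) Eu !size_cat.
have nthv i : i < size v -> nth ord0 (map to_letter u) (size s1 + i) = omega_word v0 i.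
  move=> iv; rewrite Eu nth_cat ltnNge leq_addr /= addKn nth_cat iv.
  by rewrite {1}Ev nth_mkseq.
have : den * (size v - size v0) <= num * size v0.
  have [small|large] := leqP (size v) (size v0); first by move: small; rewrite -subn_eq0 => /eqP ->; rewrite muln0.
  apply: (rep (size s1)) => //; first by lia.
  move=> j jv; apply/eqP; rewrite -letter_eq //; try lia.
  rewrite -addnA !nthv; try lia.
  by rewrite /omega_word modnDl.
move=> bound; have : den * size v <= (num + den) * size v0 by nia.
rewrite leqNgt; case/negP; rewrite -(ltr_nat rat) !natrM -Ebeta -mulrA ltr_pM2l ?ltr0n //.
by rewrite -ltr_pdivlMr ?ltr0n // Er.
Qed.

Lemma pattern_free_avoids p u : all (gtn 3) u ->
  pattern_free p (nth 0 u) (size u) -> avoids_pattern p (map to_letter u).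
Proof.
move=> u3 free v /infixP[s1 [s2 Eu]] [f finj Ev].
have szv : size v = size p by rewrite Ev size_map.
have szu : size u = size s1 + (size v + size s2) by rewrite -(size_map to_letter) Eu !size_cat.
apply: (free (size s1)) => [|i j ip jp]; first by lia.
rewrite -letter_eq //; try lia.
have nthv k : k < size p -> nth ord0 (map to_letter u) (size s1 + k) = f (nth 0 p k).
  move=> kp; rewrite Eu nth_cat ltnNge leq_addr /= addKn nth_cat szv kp.
  by rewrite Ev (nth_map 0).
by rewrite !nthv // (inj_in_eq finj) // mem_nth.
Qed.

Lemma drop_rep_bounded num den u k : rep_bounded num den (nth 0 u) (size u) ->
  rep_bounded num den (nth 0 (drop k u)) (size (drop k u)).
Proof.
move=> rep i p e p0; rewrite size_drop => le run.
have [e0|e0] := posnP e; first by rewrite e0 muln0.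
apply: (rep (k + i)) => //; first by lia.
by move=> j je; have := run j je; rewrite !nth_drop !addnA.
Qed.

Lemma drop_pattern_free p u k : 0 < size p -> pattern_free p (nth 0 u) (size u) ->
  pattern_free p (nth 0 (drop k u)) (size (drop k u)).
Proof.
move=> p0 free s; rewrite size_drop => le occ; apply: (free (k + s)); first by lia.
by move=> i j ip jp; rewrite -occ // !nth_drop !addnA.
Qed.

(** Both properties pass to suffixes, so an arbitrary length [N] is reached by cutting at most [q]
    letters off the left of an image; the factor 5 pays for the first letter of the preimage. *)
Lemma image_count num den p m cp cs imgs (beta : rat) N :
  check_images num den p m cp cs imgs -> (den%:R * beta = (num + den)%:R)%R ->
  3 ^ (N %/ size (head [::] imgs)).+1 <=
    5 * num_words (fun w => plus_free beta w /\ avoids_pattern p w) N.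
Proof.
move=> ok Ebeta; set q := size _; set n := (N %/ q).+1.
set P := fun w => _; have q0 : 0 < q := imgs_q_gt0 ok.
apply: leq_trans (num_low_exp_exp n) _.
have Nq : N <= n * q by rewrite ltnW // /n ltn_ceil.
have Nq' : n * q - N <= q by rewrite leq_subLR /n mulSn addnC leq_add2r leq_trunc_div.
pose k := n * q - N; pose V := [set w : N.-tuple letter | `[< P w >]].
(* The first letter of w may be lost by truncating its image to length N. *)
pose g w := (head 0 w, map to_letter (drop k (image imgs w))).
have drop3 w : w \in low_exp_words n -> all (gtn 3) (drop k (image imgs w)).
  move=> wn; have := image_letter ok (low_exp_words_letter wn).
  by rewrite -{1}(cat_take_drop k (image imgs w)) all_cat => /andP[].
have szi w : w \in low_exp_words n -> size (image imgs w) = n * q.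
  by move=> wn; rewrite (size_image ok (low_exp_words_letter wn)) (low_exp_words_size wn).
have -> : num_low_exp n = size (map g (low_exp_words n)) by rewrite size_map.
have -> : 5 * num_words P N = size [seq (a, tval t) | a <- iota 0 5, t <- enum V].
  by rewrite size_allpairs size_iota -cardE.
apply: uniq_leq_size.
  rewrite map_inj_in_uniq ?low_exp_words_uniq // => v w vn wn [Eh Ed].
  have {}Ed : drop k (image imgs v) = drop k (image imgs w).
    by apply: to_letter_inj Ed; apply: drop3.
  have v5 := low_exp_words_letter vn; have w5 := low_exp_words_letter wn.
  have sv := low_exp_words_size vn; have sw := low_exp_words_size wn.
  case: v w v5 w5 sv sw Eh Ed {vn wn} => [|a v] [|b w] //=.
  move=> /andP[a5 v5] /andP[b5 w5] [sv] [sw] -> Ed; congr (_ :: _).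
  apply: (image_inj ok) => //; first by rewrite sv sw.
  have skip c u : c < 5 -> image imgs u = drop (q - k) (drop k (image imgs (c :: u))).
    move=> c5; rewrite drop_drop subnK // /image /= drop_size_cat //.
    exact: (size_img ok).
  by rewrite (skip b v) // (skip b w) // /image /= Ed.
move=> _ /mapP[w wn ->].
have szt : size (map to_letter (drop k (image imgs w))) == N.
  by rewrite size_map size_drop szi // subKn.
apply/allpairsP; exists (head 0 w, Tuple szt); split => //=.
  rewrite (mem_iota 0 5) /=; have := low_exp_words_letter wn; have := low_exp_words_size wn.
  by case: (w) => //= a u _ /andP[].
rewrite mem_enum inE; apply/asboolP.
have [rep pat] := image_good ok wn.
have [den0 p0] : 0 < den /\ 0 < size p by case/and5P: ok => _ _ _ _ /and5P[_ ? /andP[? _]].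
rewrite -(szi w wn) in rep pat; split.
  by apply: rep_bounded_plus_free Ebeta _ _; rewrite ?drop3 //; apply: drop_rep_bounded.
by apply: pattern_free_avoids; rewrite ?drop3 //; apply: drop_pattern_free.
Qed.

(** * From block counts to exponential growth *)

Local Open Scope ring_scope.

Lemma bernoulli_ineq (R : realFieldType) (x : R) n : 0 <= x <= 1 -> 1 - n%:R * x <= (1 - x) ^+ n.
Proof.
case/andP=> x0 x1; elim: n => [|n IH]; first by rewrite mul0r subr0 expr0.
rewrite exprS; apply: le_trans (ler_wpM2l _ IH); last by rewrite subr_ge0.
have : 0 <= n%:R * x * x by rewrite !mulr_ge0.
rewrite -natr1; lra.
Qed.

(** Any constant [c > 1] with [c ^+ q <= 2] serves. Taking [(1 - x)^-1] with [q * x = 1/2] avoids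
    roots, by Bernoulli's inequality. *)
Lemma exponentially_many_of_blocks (R : realType) (P : seq letter -> Prop) (q : nat) :
  (0 < q)%N -> (forall N, 3 ^ (N %/ q).+1 <= 5 * num_words P N)%N ->
  exponentially_many R P.
Proof.
move=> q0 count; pose x : R := (2 * q)%:R^-1.
have q1 : 1 <= q%:R :> R by rewrite ler1n.
have Ex : q%:R * x = 2^-1.
  by rewrite /x natrM invfM mulrCA divff ?mulr1 // pnatr_eq0 -lt0n.
have x0 : 0 < x by rewrite invr_gt0 ltr0n muln_gt0.
have x1 : x <= 2^-1 by rewrite -Ex ler_peMl // ltW.
pose c : R := (1 - x)^-1.
have c1 : 1 < c by rewrite invf_gt1; lra.
have cq : c ^+ q <= 2.
  rewrite exprVn -[leRHS]invrK lef_pV2 ?posrE ?exprn_gt0 ?invr_gt0 //; last by lra.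
  by apply: le_trans (bernoulli_ineq q _); [rewrite Ex; lra | lra].
(* From [3 * q] on, [n] is at least 4, the least exponent with [5 * 2 ^ n <= 3 ^ n]. *)
exists c => //; exists (3 * q)%N => N le.
set n := (N %/ q).+1.
have n4 : (4 <= n)%N by rewrite ltnS leq_divRL.
have c2 : c ^+ N <= 2 ^+ n.
  apply: (@le_trans _ _ (c ^+ (q * n))).
    by rewrite ler_weXn2l ?(ltW c1) // ltnW // mulnC ltn_ceil.
  by rewrite exprM lerXn2r ?nnegrE ?exprn_ge0 // ltW //; lra.
apply: le_trans c2 _; rewrite -natrX ler_nat.
have := count N; rewrite -/n => cN.
have : (5 * 2 ^ n <= 3 ^ n)%N.
  rewrite -(subnKC n4) !expnD.
  have : (2 ^ (n - 4) <= 3 ^ (n - 4))%N by case: (n - 4)%N => [|k] //; rewrite leq_exp2r.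
  move: (2 ^ (n - 4))%N (3 ^ (n - 4))%N => a b ab.
  by rewrite (_ : 2 ^ 4 = 16)%N // (_ : 3 ^ 4 = 81)%N //; lia.
lia.
Qed.

Theorem theorem16 (R : realType) :
  [/\ exponentially_many R
        (fun w => plus_free (15 / 8) w /\ avoids_pattern abaca w),
      exponentially_many R
        (fun w => plus_free (11 / 6) w /\ avoids_pattern abcab w)
    & exponentially_many R
        (fun w => plus_free (7 / 4) w /\ avoids_pattern abacbc w)].
Proof.
split.
- apply: exponentially_many_of_blocks (imgs_q_gt0 check_a) _ => N.
  exact: image_count check_a _.
- apply: exponentially_many_of_blocks (imgs_q_gt0 check_b) _ => N.
  exact: image_count check_b _.
- apply: exponentially_many_of_blocks (imgs_q_gt0 check_c) _ => N.
  exact: image_count check_c _.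
Qed.
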